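(* Let $X$ be a compact metric space and $f:X\to X$ continuous. For every $f$-invariant $\mu\in\mathcal M(X)$, $$\mathscr E_\mu(f)(\epsilon)\le\mathscr E_{\mathrm{top}}(f)(\epsilon)\qquad\text{for all }\epsilon>0,$$ provided both emergences are computed using the same metric $\mathsf W_p$ (some $1\le p<\infty$) or $\mathsf{LP}$ on $\mathcal M(X)$.
   Context: For a compact metric space $(X,\mathsf d)$, $\mathcal M(X)$ is the set of Borel probability measures on $X$. For $p\ge1$, $\mathsf W_p(\mu,\nu)=\inf_\pi\left(\int_{X\times X}\mathsf d(x,y)^p\,d\pi(x,y)\right)^{1/p}$, the infimum over all probability measures $\pi$ on $X\times X$ with marginals $\mu,\nu$. $\mathsf{LP}(\mu,\nu)$ (Lévy–Prokhorov) is the infimum of $\epsilon>0$ such that for every Borel $E\subset X$, $\nu(E)\le\mu(V_\epsilon(E))+\epsilon$ and $\mu(E)\le\nu(V_\epsilon(E))+\epsilon$, where $V_\epsilon(E)$ is the $\epsilon$-neighborhood of $E$. Topological emergence: $\mathscr E_{\mathrm{top}}(f)(\epsilon)$ is the minimal number of closed $\epsilon$-balls of $\mathcal M(X)$ (for the chosen distance) whose union covers the set $\mathcal M_f^{\mathrm{erg}}(X)$ of ergodic $f$-invariant Borel probability measures. Metric emergence: for $f$-invariant $\mu$, let $\mathbf e^f(x)=\lim_{n\to\infty}\frac1n\sum_{i=0}^{n-1}\delta_{f^i(x)}$ (weak limit, which exists for $\mu$-a.e. $x$). $\mathscr E_\mu(f)(\epsilon)$ is the minimal $N$ for which there exist $\mu_1,\dots,\mu_N\in\mathcal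 M(X)$ with $\int\min_{1\le i\le N}\mathsf d(\mathbf e^f(x),\mu_i)\,d\mu(x)\le\epsilon$, where $\mathsf d$ is the chosen distance on $\mathcal M(X)$. *)

(* Defs.v *)
From HB Require Import structures.
From mathcomp Require Import all_boot all_order all_algebra.
From mathcomp Require Import all_classical all_reals all_analysis.
Set Implicit Arguments.
Unset Strict Implicit.
Unset Printing Implicit Defensive.
Import Order.TTheory GRing.Theory Num.Theory.
Import numFieldNormedType.Exports.
Local Open Scope classical_set_scope.
Local Open Scope ring_scope.
Local Open Scope ereal_scope.

(* Measurable types are pointed in MathComp-Analysis, metric types are not.
   The base point only expresses that the space is nonempty, which is implied
   by the existence of a probability measure on it. *)
#[short(type="pointedMetricType")]
HB.structure Definition PointedMetric (K : numDomainType) :=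
  {M of Metric K M & isPointed M}.

Definition borel (K : numDomainType) (X : pointedMetricType K) :
  measurableType (@open X).-sigma := g_sigma_algebraType (@open X).

Notation prob X R := (probability (borel X) R).

Section Distances.
Context {R : realType} {X : pointedMetricType R}.
Implicit Types mu nu : prob X R.

(* X * X carries the product sigma-algebra, which is its Borel sigma-algebra
   when X is compact (second countable). *)
Definition coupling mu nu : set (probability (borel X * borel X)%type R) :=
  [set pi | forall A : set (borel X), measurable A ->
     pushforward pi fst A = mu A /\ pushforward pi snd A = nu A].

Definition Wasserstein (p : R) mu nu : \bar R :=
  ereal_inf [set (\int[pi]_z (mdist (z.1 : X) (z.2 : X) `^ p)%:E) `^ p^-1%R
            | pi in coupling mu nu].

Definition neighborhood (e : R) (E : set X) : set X :=
  [set x | exists2 y, E y & (mdist x y < e)%R].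

Definition LevyProkhorov mu nu : \bar R :=
  ereal_inf [set e%:E | e in [set e : R | (0 < e)%R /\
    forall E : set (borel X), measurable E ->
      nu E <= mu (neighborhood e E) + e%:E /\
      mu E <= nu (neighborhood e E) + e%:E]].

End Distances.

Section Emergence.
Context {R : realType} {X : pointedMetricType R}.
Variable f : X -> X.
Implicit Types mu nu : prob X R.

Definition invariant_measure mu : Prop :=
  forall A : set (borel X), measurable A -> pushforward mu (f : borel X -> borel X) A = mu A.

Definition ergodic mu : Prop :=
  invariant_measure mu /\
  forall A : set (borel X), measurable A -> f @^-1` A = A ->
    mu A = 0 \/ mu A = 1.

Definition weak_cvg (mu_ : {measure set (borel X) -> \bar R}^nat) nu : Prop :=
  forall phi : X -> R, continuous phi ->
    \int[mu_ n]_x (phi x)%:E @[n --> \oo] --> \int[nu]_x (phi x)%:E.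

(* 1/n * sum_(i < n) dirac (f^i x); the zero measure for n = 0. *)
Definition empirical_measure (x : X) (n : nat) :
    {measure set (borel X) -> \bar R} :=
  mscale ((n%:R : R)^-1%:nng)%R (msum (fun i => \d_(iter i f x : borel X)) n).

Definition empirical_limits (x : X) : set (prob X R) :=
  [set nu | weak_cvg (empirical_measure x) nu].

(* The partial function e^f: its domain, and its (unique) value there. Off the
   domain, which is null for every invariant measure, e^f x is arbitrary. *)
Definition empirical_dom : set X := [set x | empirical_limits x !=set0].
Definition empirical_fun (x : X) : prob X R := get (empirical_limits x).

(* In what follows dM is a distance on the space of probability measures. The
   minimal cardinalities are taken in \bar R, with +oo if there is none. *)
Variable dM : prob X R -> prob X R -> \bar R.

Definition closed_ball_dM (c : prob X R) (eps : R) : set (prob X R) :=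
  [set nu | dM c nu <= eps%:E].

Definition top_emergence (eps : R) : \bar R :=
  ereal_inf [set N%:R%:E | N in [set N : nat | exists c : 'I_N -> prob X R,
    [set nu | ergodic nu] `<=` \bigcup_i closed_ball_dM (c i) eps]].

(* The empty minimum is +oo, so N = 0 never qualifies. The integrand, defined
   mu-almost everywhere, is integrated over its domain. *)
Definition metric_emergence mu (eps : R) : \bar R :=
  ereal_inf [set N%:R%:E | N in [set N : nat | exists c : 'I_N -> prob X R,
    \int[mu]_(x in empirical_dom)
      \big[mine/+oo]_(i < N) dM (empirical_fun x) (c i) <= eps%:E]].

End Emergence.

(* Main.v *)
Require Import Defs.
From HB Require Import structures.
From mathcomp Require Import all_boot all_order all_algebra.
From mathcomp Require Import all_classical all_reals all_analysis.
From mathcomp Require Import measurable_realfun ring lra.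
Set Implicit Arguments.
Unset Strict Implicit.
Unset Printing Implicit Defensive.
Import Order.TTheory GRing.Theory Num.Theory.
Import numFieldNormedType.Exports.
Local Open Scope classical_set_scope.
Local Open Scope ring_scope.

(** The comparison rests on the fact that, for [mu]-almost every [x], any weak
limit [nu] of the empirical measures of [x] is ergodic
([ae_empirical_limit_ergodic]).  If the ergodic measures are covered by closed
balls centred at [c_1, ..., c_N], such a [nu] lies within [eps] of some [c_i],
so [min_i d(e^f(x), c_i) <= eps] almost everywhere on the domain of [e^f], and
the same centres are admissible for the metric emergence
([metric_emergence_le_top]).  The two emergences evaluate the distance in
opposite orders, so its symmetry also enters: for Wasserstein distances it comes
from swapping the coordinates of a coupling, and for the Levy-Prokhorov distance
from the symmetry of its defining condition.

The almost sure ergodicity is obtained from a minimal-norm argument in the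
spirit of Riesz's proof of the mean ergodic theorem.  Fix a continuous [u] with
values in [0, 1], write [A_m] for the Birkhoff averages, and consider all the
iterated averages
[v = A_{m_1} (A_{m_2} (... u))].  Choose [v_j] among them with squared norm in
[L^2(mu)] within [1/(j+1)] of the infimum.  The variance of [v_j] along an orbit
segment, [V_m = A_m (v_j^2) - (A_m v_j)^2], is nonnegative, and since [mu] is
invariant its integral is [|v_j|^2 - |A_m v_j|^2 <= 1/(j+1)], because [A_m v_j]
is again an iterated average.  At a point [x] with empirical limit [nu], [V_m]
tends to the variance of [v_j] under [nu]; Fatou's lemma then shows that for
almost every [x] the infimum over [j] of these variances is zero
([ae_small_variance]).

Such a [nu] is invariant, so for an [f]-invariant Borel set [A] the integrals of
[u] and of [v] over [A] agree.  When the variance of [v] is small, [v] is nearly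
constant, whence [\int_A u dnu = nu(A) \int u dnu]
([small_variance_decorrelates]).  Taking countably many [u], among which every
indicator of an open set is a pointwise limit, gives [nu(A `&` B) = nu(A) nu(B)]
for open [B], hence for all Borel [B], and [B = A] yields [nu(A) = 0] or [1]. *)

(** * Continuous test functions approximating open sets *)

Definition test_function (R : realType) (X : pointedMetricType R)
    (u : X -> R) : Prop :=
  continuous u /\ forall x, 0 <= u x <= 1.

Lemma compact_dense_sequence (R : realType) (X : pointedMetricType R) :
  compact [set: X] ->
  exists q : nat -> X, forall x (e : R), 0 < e -> exists i, mdist (q i) x < e.
Proof.
move=> /(@compact_second_countable R X)[B /pfcard_geP cB [_ Bbasis]].
have [g gB] : exists g : nat -> set X, forall V, B V -> exists i, g i = V.
  case: cB => [B0|[g]]; first by exists (fun=> set0) => V; rewrite B0.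
  exists g => V BV; have [i _ <-] := @surj _ _ _ _ g V BV.
  by exists i.
exists (fun i => get (g i)) => x e e0.
have [V [BV Vx Ve]] := Bbasis x _ (nbhsx_ballx x e e0).
have [i giV] := gB _ BV; exists i.
rewrite giV metric_sym; have : ball x e (get V).
  by apply: Ve; apply: getPex; exists x.
by rewrite ballEmdist.
Qed.

Lemma mdist_continuous (R : realType) (X : pointedMetricType R) (a : X) :
  continuous (fun x : X => mdist a x).
Proof.
move=> x; apply/cvgrPdist_lt => e e0; near=> y.
have xy : mdist x y < e.
  by near: y; have := nbhsx_ballx x e e0; rewrite ballEmdist.
have := metric_triangle a x y; have := metric_triangle a y x.
rewrite (metric_sym y x) => h1 h2.
by rewrite ltr_norml; apply/andP; split; lra.
Unshelve. all: by end_near. Qed.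

(** Positive parts of [1/(k+1) - d(q_i, x)], with [q] a dense sequence: they form
a countable family whose positivity sets are a base of the topology. *)
Lemma bump_sequence (R : realType) (X : pointedMetricType R) :
  compact [set: X] ->
  exists b : nat -> X -> R,
    [/\ forall c, continuous (b c), forall c x, 0 <= b c x &
      forall (U : set X) x, open U -> U x ->
        exists2 c, 0 < b c x & forall y, 0 < b c y -> U y].
Proof.
move=> /compact_dense_sequence[q qdense].
pose code c : nat * nat := odflt (0, 0)%N (unpickle c).
pose b c x : R := Num.max 0 ((code c).2.+1%:R^-1 - mdist (q (code c).1) x).
exists b; split.
- move=> c x; rewrite /b; apply: (@continuous_max R X (cst 0)); first exact: cvg_cst.
  by apply: continuousB; [exact: cvg_cst|exact: mdist_continuous].
- by move=> c x; rewrite /b le_max lexx.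
- move=> U x oU Ux.
  have /nbhs_ballP[e /= e0 eU] : nbhs x U by exact: open_nbhs_nbhs.
  have [k ke] : exists k, (k.+1%:R^-1 : R) < e / 2.
    have [|k] := @ltr_add_invr R 0 (e / 2); first by rewrite divr_gt0.
    by rewrite add0r; exists k.
  have [|i ix] := qdense x (k.+1%:R^-1); first by rewrite invr_gt0.
  have bE y : (0 < b (pickle (i, k)) y) = (mdist (q i) y < k.+1%:R^-1).
    by rewrite /b /code pickleK /= lt_max ltxx subr_gt0.
  exists (pickle (i, k)); first by rewrite bE.
  move=> y; rewrite bE => iy; apply: eU; rewrite ballEmdist /=.
  apply: le_lt_trans (metric_triangle x (q i) y) _.
  by rewrite (metric_sym x (q i)) [ltRHS]splitr ltrD// (lt_trans _ ke).
Qed.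

(** A single countable sequence serves all open sets: null sets are attached to
its members one at a time, and countability lets them be united.  The members
are truncations at [1] of integer multiples of finite sums of bumps; for a given
[U], sum the first [n] bumps that live inside [U] and multiply by [n]. *)
Lemma test_function_sequence (R : realType) (X : pointedMetricType R) :
  compact [set: X] ->
  exists2 t : nat -> X -> R, (forall k, test_function (t k)) &
    forall U : set X, open U -> exists s : nat -> nat,
      forall x, t (s n) x @[n --> \oo] --> (\1_U x : R).
Proof.
move=> /bump_sequence[b [bcont b0 bU]].
pose code k : seq nat * nat := odflt ([::], 0)%N (unpickle k).
pose t k x : R := Num.min 1 ((code k).2%:R * \sum_(c <- (code k).1) b c x).
exists t => [k|U oU].
  split=> [x|x].
    apply: (@continuous_min R X (cst 1)); first exact: cvg_cst.
    apply: continuousM; first exact: cvg_cst.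
    apply: (@continuous_big R _ +%R 0 xpredT) => [|c _]; last exact: bcont.
    exact: add_continuous.
  rewrite /t ge_min lexx le_min ler01 /= andbT mulr_ge0//.
  by rewrite sumr_ge0.
pose P c := `[< forall y, 0 < b c y -> U y >].
exists (fun n => pickle ([seq c <- iota 0 n | P c], n)) => x.
have tE n : t (pickle ([seq c <- iota 0 n | P c], n)) x =
    Num.min 1 (n%:R * \sum_(c <- iota 0 n | P c) b c x).
  by rewrite /t /code pickleK /= big_filter.
have [Ux|Ux] := pselect (U x); last first.
  rewrite indicE memNset//; apply: cvg_near_cst; apply: nearW => n.
  rewrite tE big1 ?mulr0 ?min_r//= => c /asboolP Pc.
  by apply/eqP; rewrite eq_le b0 andbT leNgt; apply/negP => /Pc.
have [c c0 cU] := bU U x oU Ux.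
rewrite indicE mem_set//; apply: cvg_near_cst; near=> n.
rewrite tE; apply/min_idPl.
have nb : 1 <= n%:R * b c x.
  rewrite -ler_pdivrMr// div1r; near: n; exact: nbhs_infty_ger.
apply: le_trans nb _; rewrite ler_wpM2l//.
have cn : c \in iota 0 n.
  rewrite mem_iota add0n /=; near: n; exact: nbhs_infty_gt.
have Pc : P c by apply/asboolP.
by rewrite (big_rem c)//= Pc lerDl sumr_ge0.
Unshelve. all: by end_near. Qed.

(** * Measurability and integration of test functions *)

Lemma open_borel (R : realType) (X : pointedMetricType R) (U : set X) :
  open U -> measurable (U : set (borel X)).
Proof. by move=> oU; apply: sub_sigma_algebra. Qed.

Lemma continuous_borel_measurable (R : realType) (X : pointedMetricType R)
    (u : X -> R) (D : set (borel X)) :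
  continuous u -> measurable_fun D (u : borel X -> R).
Proof.
move=> /continuousP ucont; apply: measurable_funTS.
apply: (measurability _ (RGenOInfty.measurableE R)) => _ [_ [x ->] <-].
rewrite setTI; apply: open_borel; apply: ucont; rewrite set_itvE; exact: open_gt.
Qed.

Lemma continuous_borel_map (R : realType) (X : pointedMetricType R)
    (f : X -> X) :
  continuous f -> measurable_fun [set: borel X] (f : borel X -> borel X).
Proof.
move=> /continuousP fcont.
apply: (@measurability _ _ (borel X) (borel X) _ _ (@open X)) => //.
move=> _ [U oU <-]; rewrite setTI; apply: open_borel; exact: fcont.
Qed.

Lemma bounded_continuous_integrable (R : realType) (X : pointedMetricType R)
    (nu : prob X R) (D : set (borel X)) (u : X -> R) (M : R) :
  measurable D -> continuous u -> (forall x, `|u x| <= M) ->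
  nu.-integrable D (EFin \o u).
Proof.
move=> mD ucont uM; apply: measurable_bounded_integrable => //.
- by rewrite (le_lt_trans (probability_le1 _ _))// ltry.
- exact: continuous_borel_measurable.
- exists M; split; first by rewrite num_real.
  by move=> N MN x _ /=; rewrite (le_trans (uM x))// ltW.
Qed.

Lemma test_function_norm (R : realType) (X : pointedMetricType R)
    (u : X -> R) (x : X) : test_function u -> `|u x| <= 1.
Proof. by move=> [_ /(_ x)/andP[u0 u1]]; rewrite ger0_norm. Qed.

Lemma test_function_integrable (R : realType) (X : pointedMetricType R)
    (nu : prob X R) (D : set (borel X)) (u : X -> R) :
  measurable D -> test_function u -> nu.-integrable D (EFin \o u).
Proof.
move=> mD ut; apply: (@bounded_continuous_integrable _ _ _ _ _ 1) => //.
  by case: ut.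
by move=> x; exact: test_function_norm.
Qed.

Lemma EFin_Rintegral_test (R : realType) (X : pointedMetricType R)
    (nu : prob X R) (D : set (borel X)) (u : X -> R) :
  measurable D -> test_function u ->
  ((\int[nu]_(x in D) u x)%R%:E = \int[nu]_(x in D) (u x)%:E)%E.
Proof.
move=> mD ut; rewrite /Rintegral fineK//; apply: integrable_fin_num => //.
exact: test_function_integrable.
Qed.

Lemma eq_measure_open (R : realType) (X : pointedMetricType R)
    (m1 m2 : {measure set (borel X) -> \bar R}) :
  (m1 setT < +oo)%E -> (forall U : set X, open U -> m1 U = m2 U) ->
  forall A, measurable A -> m1 A = m2 A.
Proof.
move=> m1oo m12; apply: (@measure_unique _ R (borel X) (@open X) (fun=> setT)) => //.
- by move=> U V; exact: openI.
- by move=> _; exact: openT.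
- by rewrite bigcup_const.
Qed.

Lemma cvg_integral_test (R : realType) (X : pointedMetricType R)
    (nu : prob X R) (D : set (borel X)) (U : set X) (t : nat -> X -> R) :
  measurable D -> open U -> (forall n, test_function (t n)) ->
  (forall x, t n x @[n --> \oo] --> (\1_U x : R)) ->
  (\int[nu]_(x in D) (t n x)%:E @[n --> \oo] --> nu (U `&` D))%E.
Proof.
move=> mD oU tt tU; rewrite -integral_indic//; last exact: open_borel.
apply: (@dominated_cvg _ (borel X) R nu D mD _ _ (cst 1%E)).
- move=> n; apply/measurable_EFinP; apply: continuous_borel_measurable.
  by case: (tt n).
- by move=> x _; apply: cvg_EFin; [exact: nearW|exact: tU].
- by [].
- apply: (@test_function_integrable _ _ _ _ (cst 1)) => //.
  by split=> [x|x]; [exact: cvg_cst|rewrite ler01 lexx].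
- move=> n x _; have [_ /(_ x)/andP[t0 t1]] := tt n.
  by rewrite /= lee_fin ger0_norm.
Qed.

(** * Birkhoff averages and invariance of empirical limits *)

(** The average over the first [m + 1] iterates: the shift avoids the empty
average. *)
Definition birkhoff_avg (R : realType) (X : Type) (f : X -> X) (m : nat)
    (u : X -> R) (x : X) : R :=
  m.+1%:R^-1 * \sum_(i < m.+1) u (iter i f x).

Lemma continuous_iter (X : topologicalType) (f : X -> X) (i : nat) :
  continuous f -> continuous (iter i f).
Proof.
move=> fcont; elim: i => [|i IH] x; first exact: cvg_id.
exact: (continuous_comp (IH x) (fcont _)).
Qed.

Lemma test_function_comp (R : realType) (X : pointedMetricType R)
    (f : X -> X) (u : X -> R) :
  continuous f -> test_function u -> test_function (u \o f).
Proof.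
move=> fcont [ucont u01]; split=> x; last exact: u01.
exact: (continuous_comp (fcont x) (ucont _)).
Qed.

Lemma test_function_sqr (R : realType) (X : pointedMetricType R) (u : X -> R) :
  test_function u -> test_function (fun x => u x ^+ 2).
Proof.
move=> [ucont u01]; split=> x.
  under eq_fun do rewrite expr2; apply: continuousM; exact: ucont.
by have /andP[u0 u1] := u01 x; rewrite exprn_ge0//= exprn_ile1.
Qed.

Lemma test_function_avg (R : realType) (X : pointedMetricType R)
    (f : X -> X) (m : nat) (u : X -> R) :
  continuous f -> test_function u -> test_function (birkhoff_avg f m u).
Proof.
move=> fcont [ucont u01]; split=> x.
  apply: (@continuousM _ _ (cst _) (fun y => \sum_(i < m.+1) u (iter i f y))).
    exact: cvg_cst.
  apply: (@continuous_big R _ +%R 0 xpredT) => [|i _ {}x].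
    exact: add_continuous.
  apply: (@continuous_comp _ _ _ (iter i f) u); last exact: ucont.
  exact: continuous_iter.
rewrite /birkhoff_avg mulr_ge0 ?sumr_ge0//=; last first.
  by move=> i _; case/andP: (u01 (iter i f x)).
rewrite mulrC ler_pdivrMr// mul1r -[m.+1 in leRHS]card_ord -sumr_const.
by apply: ler_sum => i _; case/andP: (u01 (iter i f x)).
Qed.

Lemma integral_empirical_measure (R : realType) (X : pointedMetricType R)
    (f : X -> X) (x : X) (m : nat) (u : X -> R) :
  test_function u ->
  (\int[empirical_measure (R:=R) f x m.+1]_y (u y)%:E
   = (birkhoff_avg f m u x)%:E)%E.
Proof.
move=> [ucont u01].
have u0 y : (0 <= (u y)%:E)%E by rewrite lee_fin; case/andP: (u01 y).
have um : measurable_fun [set: borel X] (EFin \o (u : borel X -> R)).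
  by apply/measurable_EFinP; exact: continuous_borel_measurable.
rewrite /empirical_measure ge0_integral_mscale// ge0_integral_measure_sum//.
rewrite /birkhoff_avg EFinM -sumEFin; congr (_ * _)%E.
by apply: eq_bigr => i _; rewrite integral_dirac// diracT mul1e.
Qed.

Lemma birkhoff_avg_cvg (R : realType) (X : pointedMetricType R)
    (f : X -> X) (x : X) (nu : prob X R) (u : X -> R) :
  empirical_limits f x nu -> test_function u ->
  birkhoff_avg f m u x @[m --> \oo] --> (\int[nu]_y u y)%R.
Proof.
move=> xnu ut; have := xnu u ut.1.
rewrite -EFin_Rintegral_test// -cvg_shiftS.
under eq_fun do rewrite integral_empirical_measure//.
by move/fine_cvg.
Qed.

Lemma birkhoff_avg_comp_sub (R : realType) (X : Type) (f : X -> X) (m : nat)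
    (u : X -> R) (x : X) :
  birkhoff_avg f m (u \o f) x - birkhoff_avg f m u x
    = m.+1%:R^-1 * (u (iter m.+1 f x) - u x).
Proof.
rewrite /birkhoff_avg -mulrBr; congr (_ * _); rewrite -sumrB.
rewrite -(big_mkord xpredT (fun i => (u \o f) (iter i f x) - u (iter i f x))).
exact: (telescope_sumr (fun i => u (iter i f x))).
Qed.

(** The Birkhoff averages of [u \o f] and of [u] differ by a telescoping term of
size at most [1/(m+1)]. *)
Lemma empirical_limit_comp (R : realType) (X : pointedMetricType R)
    (f : X -> X) (x : X) (nu : prob X R) (u : X -> R) :
  continuous f -> empirical_limits f x nu -> test_function u ->
  (\int[nu]_y u (f y) = \int[nu]_y u y)%R.
Proof.
move=> fcont xnu ut.
have cvgu := birkhoff_avg_cvg xnu ut.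
have cvguf := birkhoff_avg_cvg xnu (test_function_comp fcont ut).
apply/eqP; rewrite -subr_eq0; apply/eqP.
rewrite -(cvg_lim (@norm_hausdorff _ R) (cvgB cvguf cvgu)).
apply: (cvg_lim (@norm_hausdorff _ R)).
rewrite (_ : _ - _ = fun m => m.+1%:R^-1 * (u (iter m.+1 f x) - u x)); last first.
  by apply/funext => m; exact: birkhoff_avg_comp_sub.
apply/cvgr0Pnorm_le => e e0; near=> m.
rewrite normrM ger0_norm// ler_pdivrMl//.
have b1 y : 0 <= u y <= 1 by case: ut.
have /andP[a0 a1] := b1 (iter m.+1 f x); have /andP[c0 c1] := b1 x.
apply: (@le_trans _ _ 1); first by rewrite ler_norml; apply/andP; split; lra.
rewrite -ler_pdivrMr// div1r; near: m.
have [N _ HN] := nbhs_infty_ger e^-1; exists N => //= n Nn.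
by apply: (le_trans (HN n Nn)); rewrite ler_nat.
Unshelve. all: by end_near. Qed.

(** The equality of integrals against test functions passes to open sets by
approximation, and then to Borel sets since open sets form a pi-system. *)
Lemma empirical_limit_invariant (R : realType) (X : pointedMetricType R)
    (f : X -> X) (x : X) (nu : prob X R) :
  compact [set: X] -> continuous f -> empirical_limits f x nu ->
  invariant_measure f nu.
Proof.
move=> cX fcont xnu.
have mf := continuous_borel_map fcont.
pose F : {mfun borel X >-> borel X} :=
  HB.pack (f : borel X -> borel X) (isMeasurableFun.Build _ _ _ _ _ mf).
have [t tt tU] := test_function_sequence cX.
apply: (@eq_measure_open _ _ (distribution nu F)).
  by rewrite (le_lt_trans (probability_le1 _ _))// ltry.
move=> U oU; have [s sU] := tU U oU.
have ofU : open (f @^-1` U) by move/continuousP: fcont => /(_ U oU).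
have h1 : (\int[nu]_y (t (s n) (f y))%:E @[n --> \oo] -->
    nu ((f @^-1` U) `&` setT))%E.
  apply: (@cvg_integral_test _ _ nu setT _ (fun n => t (s n) \o f)) => //.
    by move=> n; exact: test_function_comp.
  by move=> y; exact: sU.
have h2 : (\int[nu]_y (t (s n) y)%:E @[n --> \oo] --> nu (U `&` setT))%E.
  by apply: cvg_integral_test.
rewrite setIT in h1; rewrite setIT in h2.
rewrite /distribution /pushforward /=.
apply: (@cvg_unique _ (@ereal_hausdorff R) _ _ _ _ h1) => //.
rewrite [X in X @ _](_ : _ = (fun n => \int[nu]_y (t (s n) y)%:E)%E)//.
apply/funext => n; rewrite -!EFin_Rintegral_test//.
  by congr EFin; exact: (empirical_limit_comp fcont xnu).
exact: (@test_function_comp _ _ f (t (s n))).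
Qed.

Lemma Rintegral_invariant (R : realType) (X : pointedMetricType R)
    (f : X -> X) (nu : prob X R) (D : set (borel X)) (u : X -> R) :
  continuous f -> invariant_measure f nu -> measurable D -> f @^-1` D = D ->
  test_function u ->
  (\int[nu]_(y in D) u (f y) = \int[nu]_(y in D) u y)%R.
Proof.
move=> fcont nuf mD fD ut; rewrite /Rintegral; congr fine.
have mf := continuous_borel_map fcont.
rewrite -{1}fD -(@ge0_integral_pushforward _ _ _ _ _ _ mf nu D (EFin \o u))//.
- by apply: eq_measure_integral => A mA _; exact: nuf.
- by apply/measurable_EFinP; apply: continuous_borel_measurable; case: ut.
- by move=> y _; rewrite lee_fin; case: ut => _ /(_ y)/andP[].
Qed.

Lemma Rintegral_birkhoff_avg (R : realType) (X : pointedMetricType R)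
    (f : X -> X) (nu : prob X R) (D : set (borel X)) (m : nat) (u : X -> R) :
  continuous f -> invariant_measure f nu -> measurable D -> f @^-1` D = D ->
  test_function u ->
  (\int[nu]_(y in D) birkhoff_avg f m u y = \int[nu]_(y in D) u y)%R.
Proof.
move=> fcont nuf mD fD ut.
have iter_test i : test_function (fun y => u (iter i f y)).
  elim: i => [//|i IH]; have := test_function_comp fcont IH.
  by congr test_function; apply/funext => y /=; rewrite -iterS iterSr.
have iterE i : (\int[nu]_(y in D) u (iter i f y) = \int[nu]_(y in D) u y)%R.
  elim: i => [//|i <-].
  rewrite -[RHS](Rintegral_invariant fcont nuf mD fD (iter_test i)).
  by apply: eq_Rintegral => y _; rewrite iterSr.
have int_iter i := test_function_integrable nu mD (iter_test i).
rewrite /birkhoff_avg RintegralZl//; last first.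
  rewrite (_ : EFin \o _ = fun y => (\sum_(i < m.+1) (u (iter i f y))%:E)%E).
    by apply: integrable_sum => // i _; exact: int_iter.
  by apply/funext => y /=; rewrite sumEFin.
rewrite {1}/Rintegral.
under eq_integral do rewrite -sumEFin.
rewrite integral_sum//=.
under eq_bigr do rewrite -EFin_Rintegral_test// iterE.
  by rewrite sumEFin /= sumr_const card_ord -[X in _ * X]mulr_natl mulKf.
by move=> i; exact: int_iter.
Qed.

(** * Almost sure smallness of the variance of iterated averages *)

(** Iterated averages rather than the [birkhoff_avg f m u] alone: the class has to
be stable under [birkhoff_avg f m] for the minimal-norm argument. *)
Definition iterated_avg (R : realType) (X : Type) (f : X -> X) (s : seq nat)
    (u : X -> R) : X -> R :=
  foldr (birkhoff_avg f) u s.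

Lemma test_function_iterated_avg (R : realType) (X : pointedMetricType R)
    (f : X -> X) (s : seq nat) (u : X -> R) :
  continuous f -> test_function u -> test_function (iterated_avg f s u).
Proof.
by move=> fcont ut; elim: s => //= m s IH; exact: test_function_avg.
Qed.

Lemma Rintegral_iterated_avg (R : realType) (X : pointedMetricType R)
    (f : X -> X) (nu : prob X R) (D : set (borel X)) (s : seq nat) (u : X -> R) :
  continuous f -> invariant_measure f nu -> measurable D -> f @^-1` D = D ->
  test_function u ->
  (\int[nu]_(y in D) iterated_avg f s u y = \int[nu]_(y in D) u y)%R.
Proof.
move=> fcont nuf mD fD ut; elim: s => //= m s IH.
rewrite Rintegral_birkhoff_avg//; exact: test_function_iterated_avg.
Qed.

Definition orbit_variance (R : realType) (X : Type) (f : X -> X) (m : nat)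
    (u : X -> R) (x : X) : R :=
  birkhoff_avg f m (fun y => u y ^+ 2) x - birkhoff_avg f m u x ^+ 2.

Lemma orbit_variance_ge0 (R : realType) (X : Type) (f : X -> X) (m : nat)
    (u : X -> R) (x : X) : 0 <= orbit_variance f m u x.
Proof.
rewrite /orbit_variance; set a := birkhoff_avg f m u x.
suff -> : birkhoff_avg f m (fun y => u y ^+ 2) x - a ^+ 2 =
    m.+1%:R^-1 * \sum_(i < m.+1) (u (iter i f x) - a) ^+ 2.
  by rewrite mulr_ge0// sumr_ge0// => i _; exact: sqr_ge0.
have aE : \sum_(i < m.+1) u (iter i f x) = m.+1%:R * a.
  by rewrite /a /birkhoff_avg mulVKf// pnatr_eq0.
under eq_bigr do rewrite sqrrB -mulrnAr.
rewrite big_split /= sumrB -mulr_suml aE sumr_const card_ord.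
rewrite /birkhoff_avg -mulr_natl; field.
by rewrite addrC natr1 pnatr_eq0.
Qed.

Lemma limn_einf_bounds (R : realType) (u : (\bar R)^nat) (a b : \bar R) :
  (forall n, a <= u n <= b)%E -> (a <= limn_einf u <= b)%E.
Proof.
move=> ab; rewrite limn_einf_lim; apply/andP; split.
  apply: lime_ge; first exact: is_cvg_einfs.
  apply: nearW => n; apply: le_ereal_inf_tmp => _ [k _ <-].
  by case/andP: (ab k).
apply: lime_le; first exact: is_cvg_einfs.
apply: nearW => n; apply: (@le_trans _ _ (u n)); last by case/andP: (ab n).
by apply: ereal_inf_lbound; exists n => /=.
Qed.

(** Choose iterated averages whose squared [L^2(mu)] norms approach the infimum; a
further averaging cannot lower them by more than the remaining gap, and this drop is
the [mu]-integral of the orbit variance. *)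
Lemma ae_small_variance (R : realType) (X : pointedMetricType R) (f : X -> X)
    (mu : prob X R) (u : X -> R) :
  continuous f -> invariant_measure f mu -> test_function u ->
  {ae mu, forall x : borel X, forall nu : prob X R,
    empirical_limits f (x : X) nu -> forall d : R, 0 < d -> exists s,
    \int[nu]_y (iterated_avg f s u y ^+ 2)
      - (\int[nu]_y iterated_avg f s u y) ^+ 2 < d}%R.
Proof.
move=> fcont muf ut.
have at_ s : test_function (iterated_avg f s u).
  exact: test_function_iterated_avg.
have a2t s := test_function_sqr (at_ s).
pose nrm s : R := (\int[mu]_y (iterated_avg f s u y ^+ 2))%R.
have nrm_ge0 s : 0 <= nrm s by apply: Rintegral_ge0 => y _; exact: sqr_ge0.
have nrm_inf : has_inf (range nrm).
  by split; [exists (nrm [::]), [::]|exists 0 => _ [s _ <-]].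
have /choice[s sP] : forall j : nat, exists s,
    nrm s < inf (range nrm) + j.+1%:R^-1.
  move=> j; have [|_ [s _ <-] sj] := @inf_adherent _ (range nrm) j.+1%:R^-1 _ nrm_inf.
    by rewrite invr_gt0.
  by exists s.
pose k j m (x : borel X) : R := orbit_variance f m (iterated_avg f (s j) u) x.
have mk j m : measurable_fun setT (EFin \o k j m).
  apply/measurable_EFinP; apply: measurable_funB.
    by apply: continuous_borel_measurable; case: (test_function_avg m fcont (a2t (s j))).
  apply: measurable_funX; apply: continuous_borel_measurable.
  by case: (test_function_avg m fcont (at_ (s j))).
have k0 j m x : (0 <= (k j m x)%:E)%E by rewrite lee_fin orbit_variance_ge0.
have intk j m : (\int[mu]_x (k j m x)%:E <= (j.+1%:R^-1)%:E)%E.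
  have t1 := test_function_avg m fcont (a2t (s j)).
  have t2 := test_function_sqr (test_function_avg m fcont (at_ (s j))).
  under eq_integral do rewrite /k /orbit_variance EFinB.
  rewrite integralB//; [|exact: test_function_integrable..].
  rewrite -!EFin_Rintegral_test// -EFinB lee_fin.
  rewrite Rintegral_birkhoff_avg// lerBlDl.
  (* averaging once more stays in the class over which the infimum is taken *)
  apply: (le_trans (ltW (sP j))); rewrite lerD2r.
  by apply: ge_inf; [case: nrm_inf|exists (m :: s j)].
pose H j x := limn_einf (fun m => (k j m x)%:E).
have H0 j x : (0 <= H j x)%E.
  rewrite /H limn_einf_lim; apply: lime_ge; first exact: is_cvg_einfs.
  by apply: nearW => n; apply: le_ereal_inf_tmp => _ [i _ <-].
have mH j : measurable_fun setT (H j).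
  apply: (measurableT_comp (@oppe_measurable R setT)).
  apply: measurable_fun_limn_esup => m.
  exact: (measurableT_comp (@oppe_measurable R setT) (mk j m)).
have intH j : (\int[mu]_x H j x <= (j.+1%:R^-1)%:E)%E.
  have /andP[_ h] : (0 <= limn_einf (fun m => \int[mu]_x (k j m x)%:E)
      <= (j.+1%:R^-1)%:E)%E.
    by apply: limn_einf_bounds => m; rewrite intk integral_ge0.
  by apply: le_trans h; exact: (fatou mu measurableT (mk j) (fun n x _ => k0 j n x)).
pose G x := einfs (H^~ x) 0%N.
have G0 x : (0 <= G x)%E by apply: le_ereal_inf_tmp => _ [i _ <-].
have mG : measurable_fun setT G by apply: measurable_fun_einfs.
have GH j x : (G x <= H j x)%E by apply: ereal_inf_lbound; exists j.
have intG : (\int[mu]_x `|G x| = 0)%E.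
  under eq_integral do rewrite gee0_abs//.
  apply/eqP; rewrite eq_le integral_ge0// andbT.
  apply/lee_addgt0Pr => e e0; rewrite add0e.
  have [|j] := @ltr_add_invr R 0 e; first by [].
  rewrite add0r => /ltW je; apply: (@le_trans _ _ (j.+1%:R^-1)%:E); last first.
    by rewrite lee_fin.
  by apply: le_trans (intH j); apply: ge0_le_integral.
have [N [mN N0 GN]] := (ae_eq_integral_abs mu measurableT mG).1 intG.
exists N; split=> //; apply: subset_trans GN.
apply: subsetC => x /(_ Logic.I) /= Gx nu xnu d d0.
have cvgk j : (k j m x)%:E @[m --> \oo] -->
    (\int[nu]_y (iterated_avg f (s j) u y ^+ 2)
      - (\int[nu]_y iterated_avg f (s j) u y) ^+ 2)%R%:E.
  apply: cvg_EFin; first exact: nearW.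
  apply: cvgB; first exact: birkhoff_avg_cvg.
  apply: (@cvg_comp _ _ _ _ (fun y => y ^+ 2)); last exact: exprn_continuous.
  exact: birkhoff_avg_cvg.
have HE j := cvg_limn_einf_sup (cvgk j).
have : (G x < d%:E)%E by rewrite Gx lte_fin.
move=> /ereal_inf_lt[_ [j _ <-]]; rewrite /H (HE j).1 lte_fin => jd.
by exists (s j).
Qed.

(** * Ergodicity of almost every empirical limit *)

(** A weak form of Chebyshev's inequality, from [|t| <= d + t^2 / d]. *)
Lemma Rintegral_abs_le (R : realType) (X : pointedMetricType R)
    (nu : prob X R) (A : set (borel X)) (g : X -> R) (M d : R) :
  measurable A -> continuous g -> (forall x, `|g x| <= M) -> 0 < d ->
  `|\int[nu]_(y in A) g y| <= d + d^-1 * \int[nu]_y (g y ^+ 2).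
Proof.
move=> mA gcont gM d0.
have mT : measurable [set: borel X] by [].
have ig D : measurable D -> nu.-integrable D (EFin \o g).
  by move=> mD; exact: (@bounded_continuous_integrable _ _ _ _ _ M).
have iabs D : measurable D -> nu.-integrable D (EFin \o (fun y => `|g y|)).
  by move=> mD; exact: (integrable_norm (ig D mD)).
have ig2 : nu.-integrable setT (EFin \o (fun y => g y ^+ 2)).
  apply: (@bounded_continuous_integrable _ _ _ _ _ (M ^+ 2)) => //.
    by move=> y; under eq_fun do rewrite expr2; apply: continuousM; exact: gcont.
  by move=> y; rewrite normrX lerXn2r// ?nnegrE// (le_trans _ (gM y)).
have ig2d : nu.-integrable setT (EFin \o (fun y => d^-1 * g y ^+ 2)).
  exact: (integrableZl mT d^-1 ig2).
have icst : nu.-integrable [set: borel X] (EFin \o cst d).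
  by apply: (@bounded_continuous_integrable _ _ _ _ _ `|d|) => // y; exact: cvg_cst.
apply: le_trans (le_normr_Rintegral mA (ig A mA)) _.
apply: (@le_trans _ _ (\int[nu]_y `|g y|)).
  rewrite /Rintegral fine_le//.
  - exact: (integrable_fin_num mA (iabs _ mA)).
  - exact: (integrable_fin_num mT (iabs _ mT)).
  - by apply: ge0_subset_integral => //; case/integrableP: (iabs _ mT).
apply: (@le_trans _ _ (\int[nu]_y (cst d y + d^-1 * g y ^+ 2))).
  apply: le_Rintegral => //; first exact: iabs.
    exact: (integrableD mT icst ig2d).
  move=> y _ /=; rewrite -(ler_pM2l d0) mulrDr mulVKf ?gt_eqF//.
  rewrite -(real_normK (num_real (g y))).
  by have := sqr_ge0 (d - `|g y|); have := sqr_ge0 d; nra.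
rewrite RintegralD// RintegralZl// Rintegral_cst// [X in fine X](probability_setT nu) mulr1.
by [].
Qed.

(** Passing from [u] to an iterated average does not change integrals over
invariant sets, and an average of small variance is close to the constant
[\int u dnu]. *)
Lemma small_variance_decorrelates (R : realType) (X : pointedMetricType R)
    (f : X -> X) (nu : prob X R) (u : X -> R) (A : set (borel X)) :
  continuous f -> invariant_measure f nu -> test_function u ->
  measurable A -> f @^-1` A = A ->
  (forall d : R, 0 < d -> exists s,
    \int[nu]_y (iterated_avg f s u y ^+ 2)
      - (\int[nu]_y iterated_avg f s u y) ^+ 2 < d) ->
  \int[nu]_(y in A) u y = fine (nu A) * \int[nu]_y u y.
Proof.
move=> fcont nuf ut mA fA small.
have mT : measurable [set: borel X] by [].
apply/eqP; rewrite -subr_eq0 -normr_le0; apply/ler_addgt0Pl => e e0.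
rewrite addr0; set c := (\int[nu]_y u y).
have d0 : 0 < e / 2 by rewrite divr_gt0.
have [s] := small _ (exprn_gt0 2 d0).
have at_ := test_function_iterated_avg s fcont ut.
pose v := iterated_avg f s u.
have vA : \int[nu]_(y in A) v y = \int[nu]_(y in A) u y.
  exact: Rintegral_iterated_avg.
have vT : \int[nu]_y v y = c by exact: Rintegral_iterated_avg.
rewrite -/v vT => vard.
have iv D : measurable D -> nu.-integrable D (EFin \o v).
  by move=> mD; exact: test_function_integrable.
have ic D r : measurable D -> nu.-integrable D (EFin \o cst r).
  move=> mD; apply: (@bounded_continuous_integrable _ _ _ _ _ `|r|) => //.
  by move=> y; exact: cvg_cst.
have -> : \int[nu]_(y in A) u y - fine (nu A) * c =
    \int[nu]_(y in A) (v y - cst c y).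
  by rewrite RintegralB//; [rewrite vA Rintegral_cst// mulrC|exact: iv|exact: ic].
have := @Rintegral_abs_le _ _ nu A (fun y => v y - cst c y) (1 + `|c|) (e / 2) mA.
have -> : \int[nu]_y (v y - cst c y) ^+ 2 = \int[nu]_y (v y ^+ 2) - c ^+ 2.
  have iv2 : nu.-integrable setT (EFin \o (fun y => v y ^+ 2)).
    by apply: test_function_integrable => //; exact: test_function_sqr.
  have ivc : nu.-integrable setT (EFin \o (fun y => (2 * c) * v y)).
    exact: (integrableZl mT (2 * c) (iv _ mT)).
  transitivity (\int[nu]_y ((v y ^+ 2 - (2 * c) * v y) + cst (c ^+ 2) y)).
    by apply: eq_Rintegral => y _ /=; ring.
  rewrite RintegralD//; [|exact: (integrableB mT iv2 ivc)|exact: ic].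
  rewrite RintegralB// RintegralZl//; last exact: iv.
  by rewrite Rintegral_cst// [X in fine X](probability_setT nu) vT /=; ring.
move=> H; apply: le_trans (H _ _ d0) _.
- by move=> y; apply: continuousB; [case: at_ => + _; exact|exact: cvg_cst].
- by move=> y; rewrite (le_trans (ler_normB _ _))// lerD2r test_function_norm.
rewrite [leRHS]splitr lerD2l ler_pdivrMl// -expr2; exact: ltW.
Qed.

(** Independence of [A] from the test functions passes by approximation to open
sets, and from them to all Borel sets; [A] is then independent of itself. *)
Lemma ergodic_of_decorrelation (R : realType) (X : pointedMetricType R)
    (f : X -> X) (nu : prob X R) (t : nat -> X -> R) :
  invariant_measure f nu -> (forall k, test_function (t k)) ->
  (forall U : set X, open U -> exists s : nat -> nat,
      forall x, t (s n) x @[n --> \oo] --> (\1_U x : R)) ->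
  (forall (A : set (borel X)) k, measurable A -> f @^-1` A = A ->
    \int[nu]_(y in A) t k y = fine (nu A) * \int[nu]_y t k y) ->
  ergodic f nu.
Proof.
move=> nuf tt tU tA; split=> // A mA fA.
have nuAfin : nu A \is a fin_num by exact: fin_num_measure.
have fnuA0 : 0 <= fine (nu A) by rewrite fine_ge0.
have indep B : measurable B -> mrestr nu mA B = mscale (NngNum fnuA0) nu B.
  apply: eq_measure_open.
    by rewrite /= /mrestr setTI -ge0_fin_numE.
  move=> U oU; have [s sU] := tU U oU.
  have cA : (\int[nu]_(y in A) (t (s n) y)%:E @[n --> \oo] --> nu (U `&` A))%E.
    by apply: cvg_integral_test.
  have cT : ((fine (nu A))%:E * \int[nu]_y (t (s n) y)%:E @[n --> \oo] -->
      (fine (nu A))%:E * nu (U `&` setT))%E.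
    by apply: cvgeZl => //; apply: cvg_integral_test.
  rewrite /= /mrestr /mscale /= -[in RHS](setIT U).
  apply: (@cvg_unique _ (@ereal_hausdorff R) _ _ _ _ cA) => //.
  rewrite [X in X @ _](_ : _ =
      (fun n => (fine (nu A))%:E * \int[nu]_y (t (s n) y)%:E)%E)//.
  by apply/funext => n; rewrite -!EFin_Rintegral_test// -EFinM tA.
have := indep A mA; rewrite /mrestr /mscale /= setIid -(fineK nuAfin) /=.
rewrite -EFinM => -[pp].
have /eqP : fine (nu A) * (1 - fine (nu A)) = 0 by rewrite mulrBr mulr1 -pp subrr.
rewrite mulf_eq0 subr_eq0 => /orP[/eqP ->|/eqP <-]; first by left.
by right.
Qed.

Lemma ae_empirical_limit_ergodic (R : realType) (X : pointedMetricType R)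
    (f : X -> X) (mu : prob X R) :
  compact [set: X] -> continuous f -> invariant_measure f mu ->
  {ae mu, forall x : borel X, forall nu : prob X R,
    empirical_limits f (x : X) nu -> ergodic f nu}.
Proof.
move=> cX fcont muf; have [t tt tU] := test_function_sequence cX.
pose small k := [set x : borel X | forall nu : prob X R,
    empirical_limits f (x : X) nu -> forall d : R, 0 < d -> exists s,
    \int[nu]_y (iterated_avg f s (t k) y ^+ 2)
      - (\int[nu]_y iterated_avg f s (t k) y) ^+ 2 < d].
have nsmall : mu.-negligible (\bigcup_k ~` small k).
  by apply: negligible_bigcup => k; exact: ae_small_variance.
apply: negligibleS nsmall => x xne; apply: contrapT => xsmall; apply: xne.
move=> nu xnu; have nuf := empirical_limit_invariant cX fcont xnu.
apply: (ergodic_of_decorrelation nuf tt tU) => A k mA fA.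
apply: small_variance_decorrelates => // d d0.
suff /(_ nu xnu d d0) : small k x by [].
by apply: contrapT => xk; apply: xsmall; exists k.
Qed.

(** * Symmetry of the distances *)

(** By density of [q], [d(x, y) < r] if and only if
[d(q_i, x) + d(q_i, y) < r] for some [i], a countable union of measurable
conditions for the product sigma-algebra. *)
Lemma measurable_mdist (R : realType) (X : pointedMetricType R) :
  compact [set: X] ->
  measurable_fun [set: (borel X * borel X)%type]
    (fun z => mdist (z.1 : X) (z.2 : X)).
Proof.
move=> /compact_dense_sequence[q qdense].
apply: (measurability _ (RGenInftyO.measurableE R)) => _ [_ [r ->] <-].
rewrite setTI set_itvE.
pose S i := [set z : borel X * borel X |
  mdist (q i) (z.1 : X) + mdist (q i) (z.2 : X) < r].
rewrite (_ : _ @^-1` _ = \bigcup_i S i).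
  apply: bigcup_measurable => i _.
  have mi : measurable_fun [set: borel X] (fun x : borel X => mdist (q i) (x : X)).
    by apply: continuous_borel_measurable; exact: mdist_continuous.
  have mS : measurable_fun [set: (borel X * borel X)%type]
      (fun z : borel X * borel X =>
        mdist (q i) (z.1 : X) + mdist (q i) (z.2 : X)).
    apply: measurable_funD; first exact: (measurableT_comp mi measurable_fst).
    exact: (measurableT_comp mi measurable_snd).
  have := mS measurableT `]-oo, r[%classic (measurable_itv _).
  by rewrite setTI set_itvE.
apply/seteqP; split=> -[x y] /=; last first.
  move=> [i _]; rewrite /S /=; apply: le_lt_trans.
  by rewrite (metric_sym (q i) x) metric_triangle.
move=> xyr; have [|i qx] := qdense x ((r - mdist (x : X) (y : X)) / 2).
  by rewrite divr_gt0// subr_gt0.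
exists i => //; rewrite /S /=.
have := metric_triangle (q i : X) (x : X) (y : X); lra.
Qed.

Lemma Wasserstein_sym (R : realType) (X : pointedMetricType R) (p : R)
    (mu nu : prob X R) :
  compact [set: X] -> Wasserstein p mu nu = Wasserstein p nu mu.
Proof.
move=> cX; have md := measurable_mdist cX.
have mcost : measurable_fun [set: (borel X * borel X)%type]
    (fun z => (mdist (z.1 : X) (z.2 : X) `^ p)%:E).
  apply/measurable_EFinP; exact: (measurableT_comp (measurable_powR p) md).
pose sw (z : borel X * borel X) : borel X * borel X := (z.2, z.1).
have msw : measurable_fun setT sw.
  by apply: measurable_fun_pair; [exact: measurable_snd|exact: measurable_fst].
pose SW : {mfun (borel X * borel X)%type >-> (borel X * borel X)%type} :=
  HB.pack sw (isMeasurableFun.Build _ _ _ _ _ msw).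
suff le_sym (m n : prob X R) : (Wasserstein p n m <= Wasserstein p m n)%E.
  by apply/eqP; rewrite eq_le !le_sym.
apply: ereal_inf_le_tmp => _ [pi pimn <-].
exists (distribution pi SW).
  by move=> A mA; have [? ?] := pimn A mA; split.
congr (_ `^ _)%E.
rewrite (ge0_integral_distribution SW mcost); last first.
  by move=> z; rewrite lee_fin powR_ge0.
by apply: eq_integral => z _ /=; rewrite metric_sym.
Qed.

Lemma LevyProkhorov_sym (R : realType) (X : pointedMetricType R)
    (mu nu : prob X R) : LevyProkhorov mu nu = LevyProkhorov nu mu.
Proof.
congr ereal_inf; apply/seteqP.
by split=> _ [e [e0 H] <-]; exists e => //; split=> // E mE;
  have [] := H E mE.
Qed.

(** * Comparison of the emergences *)

Import HBNNSimple.

(** The integral of the positive part is a supremum over simple functions below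
it, each of which inherits the bound almost everywhere.  This argument covers
the domain of the empirical function and the distance to finitely many measures,
whose measurability is not established. *)
Lemma integral_le_ae_bound (d : measure_display) (T : measurableType d)
    (R : realType) (mu : probability T R) (D : set T) (g : T -> \bar R) (r : R) :
  0 <= r -> {ae mu, forall x, D x -> (g x <= r%:E)%E} ->
  (\int[mu]_(x in D) g x <= r%:E)%E.
Proof.
move=> r0 gr; rewrite integralE.
apply: (@le_trans _ _ (\int[mu]_(x in D) (g^\+ x))%E).
  by rewrite -[leRHS]adde0 leeD2l// oppe_le0 integral_ge0.
rewrite ge0_integralE//; apply: ge_ereal_sup => _ [h /= hg <-].
rewrite -integralT_nnsfun.
apply: (@le_trans _ _ (\int[mu]_x (cst r%:E x))%E); last first.
  by rewrite integral_cst// [X in (_ * X)%E](probability_setT mu) mule1.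
apply: ae_ge0_le_integral => //.
- by move=> x _; rewrite lee_fin.
- by apply/measurable_EFinP.
apply: negligibleS gr => x xr gx; apply: xr => _.
apply: le_trans (hg x) _; rewrite /patch; case: ifPn => [|_]; last by rewrite lee_fin.
by rewrite inE => Dx; rewrite funeposE ge_max gx// lee_fin.
Qed.

Lemma metric_emergence_le_top (R : realType) (X : pointedMetricType R)
    (f : X -> X) (mu : prob X R) (dM : prob X R -> prob X R -> \bar R) (eps : R) :
  compact [set: X] -> continuous f -> invariant_measure f mu ->
  (forall m n, dM m n = dM n m) -> 0 <= eps ->
  (metric_emergence f dM mu eps <= top_emergence f dM eps)%E.
Proof.
move=> cX fcont muf dMC eps0.
apply: ereal_inf_le_tmp => _ [N [c ccover] <-]; exists N => //; exists c.
apply: integral_le_ae_bound => //.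
have := ae_empirical_limit_ergodic cX fcont muf.
apply: negligibleS => x xN erg; apply: xN => dx.
have xlim : empirical_limits f x (empirical_fun f x) by exact: getPex.
have [i _ ci] := ccover _ (erg _ xlim).
apply: le_trans (bigmin_le _ i _) _; rewrite dMC; exact: ci.
Qed.

Theorem proposition3p14 (R : realType) (X : pointedMetricType R)
    (X_compact : compact [set: X]) (f : X -> X) (f_cont : continuous f)
    (mu : prob X R) (mu_inv : invariant_measure f mu) :
  (forall (p : R) (eps : R), 1 <= p -> 0 < eps ->
     (metric_emergence f (Wasserstein p) mu eps
        <= top_emergence f (Wasserstein p) eps)%E) /\
  (forall eps : R, 0 < eps ->
     (metric_emergence f LevyProkhorov mu eps
        <= top_emergence f LevyProkhorov eps)%E).
Proof.
split=> [p eps _ eps0|eps eps0]; apply: metric_emergence_le_top => //; try exact: ltW.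
- by move=> m n; exact: Wasserstein_sym.
- exact: LevyProkhorov_sym.
Qed.
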